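(* Let $E$ and $A$ be complex Banach spaces. Then $\mathbb W(E^*,A)$ is a closed subspace (with respect to the operator norm) of the space $\mathbb K(E^*,A)$ of compact linear operators from $E^*$ to $A$.
   Context: A linear operator $\Lambda:E^*\to A$ is called weak* continuous on bounded sets (wcbs) if for every bounded net $(\psi_\lambda)$ in $E^*$, $\psi_\lambda\to\psi$ in the weak* topology implies $\Lambda(\psi_\lambda)\to\Lambda(\psi)$ in the norm of $A$. $\mathbb W(E^*,A)$ denotes the space of all wcbs linear operators $E^*\to A$. *)

(* Defs.v *)
From HB Require Import structures.
From mathcomp Require Import all_boot all_order all_algebra.
From mathcomp Require Import all_classical all_reals all_analysis.
From mathcomp Require Import complex.

Set Implicit Arguments.
Unset Strict Implicit.
Unset Printing Implicit Defensive.

Import Order.TTheory GRing.Theory Num.Theory.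
Import numFieldNormedType.Exports.

Local Open Scope classical_set_scope.
Local Open Scope ring_scope.
Local Open Scope complex_scope.

Section BoundedOperators.
Context {R : realType} (V W : normedModType R[i]).

Definition bounded_op_pred : {pred V -> W} :=
  [pred f : V -> W | `[< linear f /\ continuous f >]].

Record bounded_op := BoundedOp {
  bounded_op_fun :> V -> W;
  bounded_op_funP : bounded_op_fun \in bounded_op_pred
}.

HB.instance Definition _ := [isSub for bounded_op_fun].
HB.instance Definition _ := [Choice of bounded_op by <:].

Lemma bounded_op_submod_closed : submod_closed bounded_op_pred.
Proof.
split=> [|a f g]; rewrite !inE; first split.
- by move=> a x y; rewrite scaler0 addr0.
- by move=> x; exact: cvg_cst.
move=> [lf cf] [lg cg]; split=> [b x y|x].
  have E h (z : V) : (a *: h + g : V -> W) z = a *: h z + g z by [].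
  by rewrite !E lf lg !scalerDr !scalerA (mulrC a) addrACA.
by apply: cvgD; [apply: cvgZr; exact: cf|exact: cg].
Qed.

HB.instance Definition _ := GRing.isSubmodClosed.Build _ _ bounded_op_pred
  bounded_op_submod_closed.
HB.instance Definition _ := [SubChoice_isSubLmodule of bounded_op by <:].

Lemma bounded_op_linear (f : bounded_op) : linear f.
Proof. by have := bounded_op_funP f; rewrite inE => -[]. Qed.

Lemma bounded_op_continuous (f : bounded_op) : continuous f.
Proof. by have := bounded_op_funP f; rewrite inE => -[]. Qed.

HB.instance Definition _ (f : bounded_op) :=
  GRing.isLinear.Build _ _ _ _ (bounded_op_fun f) (bounded_op_linear f).

(* The norm of a normedModType R[i] takes its values in R[i], in the
   nonnegative reals: Re converts it to R, where sup lives. *)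
Definition opnorm (f : V -> W) : R[i] :=
  (sup [set complex.Re `|f x| | x in [set x : V | `|x| <= 1]])%:C.

Lemma Re_normE (U : normedModType R[i]) (x : U) :
  (complex.Re `|x|)%:C = `|x|.
Proof. by rewrite RRe_real// ger0_real. Qed.

Lemma bounded_op_bounded (f : bounded_op) :
  exists M : R, forall x : V, `|x| <= 1 -> complex.Re `|f x| <= M.
Proof.
have /linear_bounded_continuous/bounded_funP/(_ 1)[M fM] :=
  @bounded_op_continuous f.
exists (complex.Re M) => x /fM; rewrite lecE => /andP[_ ].
by [].
Qed.

Lemma opnorm_ge (f : bounded_op) (x : V) : `|x| <= 1 -> `|f x| <= opnorm f.
Proof.
move=> x1; rewrite -Re_normE /opnorm lecR; apply: ub_le_sup; last by exists x.
by have [M fM] := bounded_op_bounded f; exists M => _ [y y1 <-]; exact: fM.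
Qed.

Lemma opnorm_ge0 (f : bounded_op) : 0 <= opnorm f.
Proof.
by have := @opnorm_ge f 0; rewrite normr0 => /(_ ler01); exact: le_trans.
Qed.

Lemma opnorm_le (f : V -> W) (M : R[i]) :
  (forall x, `|x| <= 1 -> `|f x| <= M) -> opnorm f <= M.
Proof.
move=> fM; have M0 : 0 <= M.
  by have := fM 0; rewrite normr0 => /(_ ler01); exact: le_trans.
rewrite -[M]RRe_real ?ger0_real// /opnorm lecR; apply: ge_sup.
  by exists (complex.Re `|f 0|), 0 => //=; rewrite normr0.
by move=> _ [x /fM + <-]; rewrite lecE => /andP[].
Qed.

Lemma opnormP (f : bounded_op) (x : V) : `|f x| <= opnorm f * `|x|.
Proof.
have [->|x0] := eqVneq x 0; first by rewrite linear0 !normr0 mulr0.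
have := @opnorm_ge f (`|x|^-1 *: x).
rewrite linearZ/= !normrZ normfV normr_id mulVf ?normr_eq0//.
by move=> /(_ (lexx _)); rewrite mulrC ler_pdivrMr ?normr_gt0.
Qed.

Let opnormD (f g : bounded_op) : opnorm (f + g : bounded_op) <= opnorm f + opnorm g.
Proof.
apply: opnorm_le => x x1; apply: (le_trans (ler_normD (f x) (g x))).
by apply: lerD; exact: opnorm_ge.
Qed.

Let opnormZ (a : R[i]) (f : bounded_op) :
  opnorm (a *: f : bounded_op) = `|a| * opnorm f.
Proof.
have le b (g : bounded_op) : opnorm (b *: g : bounded_op) <= `|b| * opnorm g.
  apply: opnorm_le => x x1; rewrite [leLHS](normrZ b (g x)).
  by rewrite ler_wpM2l// opnorm_ge.
apply/le_anti/andP; split; first exact: le.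
have [->|a0] := eqVneq a 0.
  by rewrite normr0 mul0r; exact: opnorm_ge0.
have := le a^-1 (a *: f : bounded_op); rewrite scalerA mulVf// scale1r.
by rewrite normfV mulrC ler_pdivlMr ?normr_gt0// mulrC.
Qed.

Let opnorm0_eq0 (f : bounded_op) : opnorm f = 0 -> f = 0.
Proof.
move=> f0; apply/val_inj/funext => x; apply/eqP.
by rewrite -normr_le0 (le_trans (opnormP f x))// f0 mul0r.
Qed.

HB.instance Definition _ := Lmodule_isNormed.Build R[i] bounded_op
  opnormD opnormZ opnorm0_eq0.

Lemma bounded_op_normE (f : bounded_op) : `|f| = opnorm f.
Proof. by []. Qed.

End BoundedOperators.
Arguments bounded_op {R} V W.
Arguments bounded_op_pred {R} V W.

Section CompactOperators.
Context {R : realType} (V W : normedModType R[i]).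

Definition is_compact_op (f : V -> W) : Prop :=
  precompact (f @` [set x : V | `|x| <= 1]).

Definition compact_op_pred : {pred bounded_op V W} :=
  [pred f : bounded_op V W | `[< is_compact_op f >]].

Record compact_op := CompactOp {
  compact_op_val :> bounded_op V W;
  compact_op_valP : compact_op_val \in compact_op_pred
}.

HB.instance Definition _ := [isSub for compact_op_val].
HB.instance Definition _ := [Choice of compact_op by <:].

Lemma compact_op_submod_closed : submod_closed compact_op_pred.
Proof.
split=> [|a f g]; rewrite !inE /is_compact_op.
  apply: (@precompact_subset _ _ [set (0 : W)]); first by move=> _ [x _ <-].
  rewrite precompact_closed; first exact: compact_set1.
  apply: compact_closed; [exact: norm_hausdorff|exact: compact_set1].
move=> cf cg; rewrite precompactE in cf; rewrite precompactE in cg.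
pose h (p : W * W) := a *: p.1 + p.2.
have ch : continuous h.
  move=> p; apply: cvgD; last exact: cvg_snd.
  by apply: cvgZr; exact: cvg_fst.
have cfg := continuous_compact (continuous_subspaceT ch) (compact_setX cf cg).
apply: precompact_subset; last first.
  rewrite precompact_closed; first exact: cfg.
  by apply: compact_closed cfg; exact: norm_hausdorff.
move=> _ [x x1 <-]; exists (f x, g x) => //.
by split; apply: subset_closure; exists x.
Qed.

HB.instance Definition _ := GRing.isSubmodClosed.Build _ _ compact_op_pred
  compact_op_submod_closed.
HB.instance Definition _ := [SubChoice_isSubLmodule of compact_op by <:].

Let compact_opD (f g : compact_op) :
  `|(f + g : compact_op) : bounded_op V W| <=
  `|(f : bounded_op V W)| + `|(g : bounded_op V W)|.
Proof. exact: ler_normD. Qed.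

Let compact_opZ (a : R[i]) (f : compact_op) :
  `|(a *: f : compact_op) : bounded_op V W| = `|a| * `|f : bounded_op V W|.
Proof. exact: normrZ. Qed.

Let compact_op0_eq0 (f : compact_op) : `|f : bounded_op V W| = 0 -> f = 0.
Proof. by move=> /normr0_eq0 f0; apply/val_inj. Qed.

HB.instance Definition _ := Lmodule_isNormed.Build R[i] compact_op
  compact_opD compact_opZ compact_op0_eq0.

Lemma compact_op_normE (f : compact_op) : `|f| = opnorm f.
Proof. by []. Qed.

End CompactOperators.
Arguments compact_op {R} V W.

Section WeakStar.
Context {R : realType} (E : normedModType R[i]).

Definition dual : Type := bounded_op E R[i]^o.
HB.instance Definition _ := NormedModule.on dual.

Definition weak_star : Type :=
  initial_topology (fun psi : dual => (psi : {ptws E -> R[i]^o})).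
HB.instance Definition _ := Topological.on weak_star.

Lemma weak_star_cvgP (F : set_system dual) (phi : dual) : Filter F ->
  F --> (phi : weak_star) <->
  forall x : E, (psi : dual) x @[psi --> F] --> (phi x : R[i]^o).
Proof.
move=> FF; pose ev (psi : dual) : {ptws E -> R[i]^o} := psi.
have -> : (F --> (phi : weak_star)) = (ev @ F --> ev phi).
  apply/propext; split=> [Fphi B /= evB|evF].
    by apply: Fphi; exact: (@initial_continuous dual _ ev phi B evB).
  move=> N; rewrite nbhsE => -[U [Uo Uphi] sUN].
  case: Uo => B Bo BU.
  apply: (filterS sUN); rewrite -BU; apply: evF; apply: open_nbhs_nbhs.
  by split=> //; move: Uphi; rewrite -BU.
exact: (@pointwise_cvgP E R[i]^o (ev @ F) (ev phi)).
Qed.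
End WeakStar.
Arguments dual {R} E.
Arguments weak_star {R} E.

Section Nets.
Context {I : Type} (le : I -> I -> Prop).

Definition directed : Prop :=
  [/\ inhabited I, forall i, le i i,
      forall i j k, le i j -> le j k -> le i k
    & forall i j, exists2 k, le i k & le j k].

(* Convergence along this filter is Moore-Smith convergence. *)
Definition net_filter : set_system I :=
  filter_from [set: I] (fun i => [set j | le i j]).

Lemma net_filter_proper : directed -> ProperFilter net_filter.
Proof.
move=> [[i0] le_refl le_tr dir]; apply: filter_from_proper; last first.
  by move=> i _; exists i; exact: le_refl.
apply: filter_from_filter => [|i j _ _]; first by exists i0.
have [k ik jk] := dir i j; exists k => // l kl.
by split; [exact: le_tr ik kl|exact: le_tr jk kl].
Qed.
End Nets.

Section WeakStarContinuousOnBoundedSets.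
Context {R : realType} (E A : normedModType R[i]).

Definition wcbs (L : dual E -> A) : Prop :=
  forall (I : Type) (le : I -> I -> Prop), directed le ->
  forall (psi : I -> dual E) (phi : dual E),
    (exists M : R[i], forall i, `|psi i| <= M) ->
    psi @ net_filter le --> (phi : weak_star E) ->
    L (psi i) @[i --> net_filter le] --> L phi.

Definition wcbs_ops : set (dual E -> A) := [set L | linear L /\ wcbs L].

End WeakStarContinuousOnBoundedSets.
Arguments wcbs_ops {R} E A.

(* Main.v *)
(* By Banach-Alaoglu the unit ball of E^* is weak* compact, and a wcbs operator
   is weak*-to-norm continuous on it, so it maps the ball to a compact set.
   Compactness is tested on ultrafilters. Weak*-to-norm continuity is assumed
   for nets only; it passes to a filter F through the net of pairs (psi, U) with
   psi \in U \in F, ordered by reverse inclusion of the U. Closedness of the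
   wcbs operators is the usual three-epsilon argument. *)
Require Import Defs.
From mathcomp Require Import all_boot all_order all_algebra.
From mathcomp Require Import all_classical all_reals all_analysis.
From mathcomp Require Import complex.
Set Implicit Arguments.
Unset Strict Implicit.
Unset Printing Implicit Defensive.
Import Order.TTheory GRing.Theory Num.Theory.
Import numFieldNormedType.Exports.
Local Open Scope classical_set_scope.
Local Open Scope ring_scope.
Local Open Scope complex_scope.

(** If the preimage of [B] is not in [F], its complement is, and a proper filter [G] finer than the
    image would contain both [B] and its complement. *)
Lemma ultra_fmap (T U : Type) (f : T -> U) (F : set_system T) :
  UltraFilter F -> UltraFilter (f @ F).
Proof.
move=> FU; split; first exact: fmap_proper_filter.
move=> G GF sFG; apply/seteqP; split=> [B GB|]; last exact: sFG.
have [//|FnB] := in_ultra_setVsetC (f @^-1` B) FU.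
have /filter_ex[y [By nBy]] : G (B `&` ~` B) by apply: filterI => //; exact: sFG.
by [].
Qed.

Lemma ultra_bounded_cvgR (R : realType) (T : Type) (F : set_system T)
    (f : T -> R) (M : R) :
  UltraFilter F -> F [set t | `|f t| <= M] -> exists l : R, f @ F --> l.
Proof.
move=> FU FM; have := @segment_compact R (- M) M.
rewrite compact_ultra => /(_ (f @ F) (ultra_fmap f FU)) [|l [_ fl]].
  by apply: (@filterS _ F _ _ _ _ FM) => t; rewrite /= in_itv/= -ler_norml.
by exists l.
Qed.

(** A positive [e : R[i]] has zero imaginary part, so the estimate reduces to the real one for
    [complex.Re e]. *)
Lemma real_complex_cvg (R : realType) (T : Type) (F : set_system T)
    (f : T -> R) (l : R) : Filter F ->
  f @ F --> l -> (fun t => (f t)%:C : R[i]^o) @ F --> (l%:C : R[i]^o).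
Proof.
move=> FF fl; apply/cvgrPdist_lt => e e0.
move: (e0); rewrite ltcE/= => /andP[/eqP ie re0].
near=> t.
rewrite -rmorphB/= normc_def/= expr0n/= addr0 sqrtr_sqr.
rewrite ltcE/= ie eqxx/=; near: t.
by move/cvgrPdist_lt : fl; exact.
Unshelve. all: by end_near. Qed.

Lemma complex_norm_ge_Re_Im (R : realType) (z : R[i]^o) (M : R[i]) :
  `|z| <= M -> `|complex.Re z| <= complex.Re M /\ `|complex.Im z| <= complex.Re M.
Proof.
rewrite normc_def lecE/= => /andP[_ zM].
by split; apply: le_trans zM;
  rewrite -sqrtr_sqr ler_wsqrtr// ?lerDl ?lerDr sqr_ge0.
Qed.

Lemma ultra_bounded_cvgC (R : realType) (T : Type) (F : set_system T)
    (f : T -> R[i]^o) (M : R[i]) :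
  UltraFilter F -> F [set t | `|f t| <= M] -> exists l : R[i]^o, f @ F --> l.
Proof.
move=> FU FM.
have FRe : F [set t | `|complex.Re (f t)| <= complex.Re M].
  by apply: filterS FM => t fM; have [] := complex_norm_ge_Re_Im fM.
have FIm : F [set t | `|complex.Im (f t)| <= complex.Re M].
  by apply: filterS FM => t fM; have [] := complex_norm_ge_Re_Im fM.
have [a fa] := ultra_bounded_cvgR FU FRe.
have [b fb] := ultra_bounded_cvgR FU FIm.
exists (a%:C + 'i%C * b%:C).
have -> : f = (fun t => (complex.Re (f t))%:C + 'i%C * (complex.Im (f t))%:C).
  by apply/funext => t; rewrite -complexE.
apply: cvgD; first exact: real_complex_cvg.
exact: (@cvgZr _ R[i]^o _ _ _ 'i%C _ _ (real_complex_cvg _ fb)).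
Qed.

Lemma linear_normr_le_continuous (K : numFieldType) (V W : normedModType K)
    (f : V -> W) (M : K) :
  0 <= M -> linear f -> (forall x, `|f x| <= M * `|x|) -> continuous f.
Proof.
move=> M0 lf fM x; apply/cvgrPdist_le => e e0.
(* [M] may be 0, whereas [M + 1] can be divided by. *)
have M1 : 0 < M + 1 by rewrite ltr_wpDl.
near=> y.
have -> : f x - f y = f (x - y) by rewrite (addrC x) -[- y]scaleN1r lf scaleN1r addrC.
rewrite (le_trans (fM _))// (@le_trans _ _ ((M + 1) * `|x - y|))//.
  by rewrite ler_wpM2r// lerDl.
rewrite mulrC -ler_pdivlMr//; near: y.
by apply: cvgr_dist_le => //; exact: divr_gt0.
Unshelve. all: by end_near. Qed.

Section DualBall.
Context {R : realType} (E : normedModType R[i]).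

(** Banach-Alaoglu for ultrafilters: each evaluation is bounded along [F], hence converges, and the
    pointwise limit inherits linearity and the bound [M]. *)
Lemma dual_ball_ultra_cvg (F : set_system (dual E)) (M : R[i]) :
  UltraFilter F -> F [set psi | `|psi| <= M] ->
  exists2 phi : dual E, `|phi| <= M & F --> (phi : weak_star E).
Proof.
move=> FU FM.
have M0 : 0 <= M by have [psi /=] := filter_ex FM; exact: le_trans.
have FMx x : F [set psi : dual E | `|psi x| <= M * `|x|].
  apply: filterS FM => psi /= psiM; apply: (le_trans (opnormP psi x)).
  by rewrite ler_wpM2r.
have /choice[phi Fphi] x :
    exists l : R[i]^o, (psi : dual E) x @[psi --> F] --> l.
  exact: ultra_bounded_cvgC (FMx x).
have phi_lin : linear phi.
  move=> a x y; apply: (cvg_unique _ (Fphi (a *: x + y))).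
    exact: norm_hausdorff.
  have -> : (fun psi : dual E => psi (a *: x + y) : R[i]^o) =
            (fun psi : dual E => a *: (psi x : R[i]^o) + psi y).
    by apply/funext => psi; rewrite linearP.
  by apply: cvgD; [exact: cvgZr|].
have phi_le x : `|phi x| <= M * `|x|.
  apply/ler_addgt0Pr => e e0.
  have /cvgrPdist_le/(_ e e0) Fe := Fphi x.
  have [psi [/= psie psiM]] := filter_ex (filterI Fe (FMx x)).
  rewrite -[phi x](subrK (psi x)) (le_trans (ler_normD _ _))//.
  by rewrite addrC lerD.
have phi_cont := linear_normr_le_continuous M0 phi_lin phi_le.
have phiP : phi \in bounded_op_pred E R[i]^o by rewrite inE.
exists (BoundedOp phiP : dual E); last exact/weak_star_cvgP.
apply: opnorm_le => x x1; apply: (le_trans (phi_le x)).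
by rewrite ler_piMr.
Qed.

End DualBall.

Section Wcbs.
Context {R : realType} (E A : normedModType R[i]).
Implicit Types (L : dual E -> A) (phi : dual E) (F : set_system (dual E)).

Lemma wcbs_filter L F phi (M : R[i]) : ProperFilter F -> wcbs L ->
  F [set psi | `|psi| <= M] -> F --> (phi : weak_star E) -> L @ F --> L phi.
Proof.
move=> FF wL FM Fphi.
(* The norm bound is part of the index, so that the net of first components is bounded. *)
pose S := {p : dual E * set (dual E) | [/\ F p.2, p.2 p.1 & `|p.1| <= M]}.
pose le (p q : S) := (sval q).2 `<=` (sval p).2.
have S_ex (U : set (dual E)) : F U -> exists s : S, (sval s).2 = U.
  move=> FU; have [psi [Upsi psiM]] := filter_ex (filterI FU FM).
  by exists (exist _ (psi, U) (And3 FU Upsi psiM)).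
have dir : directed le.
  split.
  - by have [s _] := S_ex _ FM; exists.
  - by move=> s.
  - by move=> s t u st tu; exact: subset_trans st.
  - move=> s t; have [Fs _ _] := svalP s; have [Ft _ _] := svalP t.
    have [u uE] := S_ex _ (filterI Fs Ft).
    by exists u; rewrite /le uE; [exact: subIsetl|exact: subIsetr].
pose psi (s : S) := (sval s).1.
have psiM : exists M, forall s, `|psi s| <= M.
  by exists M => s; have [] := svalP s.
have psi_phi : psi @ net_filter le --> (phi : weak_star E).
  apply: cvg_trans Fphi => U FU; have [s sE] := S_ex _ FU.
  by exists s => // t; rewrite /le sE; apply; have [] := svalP t.
have := wL S le dir psi phi psiM psi_phi.
move=> Lpsi N /Lpsi [s _ sN]; have [Fs _ _] := svalP s.
(* Any [xi] of norm at most [M] in the set of [s], paired with that same set, is an index beyond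
   [s]. The tail at [s] thus covers a whole member of [F]. *)
apply: (@filterS _ F _ _ _ _ (filterI Fs FM)) => xi [sxi xiM].
pose t : S := exist _ (xi, (sval s).2) (And3 Fs sxi xiM).
have st : le s t by [].
exact: (sN t st).
Qed.

(** Evaluation at [x] is Lipschitz in the functional. This lets [wcbs_filter] be applied to norm
    neighbourhoods. *)
Lemma dual_norm_weak_cvg phi : nbhs phi --> (phi : weak_star E).
Proof.
apply/weak_star_cvgP => x; apply/cvgrPdist_lt => e e0.
have x0 : 0 < `|x| + 1 by rewrite ltr_wpDl.
near=> psi.
have -> : phi x - psi x = (phi - psi : dual E) x by [].
apply: (le_lt_trans (opnormP _ x)).
rewrite (@le_lt_trans _ _ (`|phi - psi| * (`|x| + 1)))//.
  by rewrite ler_wpM2l ?opnorm_ge0 ?lerDl.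
rewrite -ltr_pdivlMr//; near: psi.
by apply: cvgr_dist_lt => //; exact: divr_gt0.
Unshelve. all: by end_near. Qed.

Lemma wcbs_continuous L : wcbs L -> continuous L.
Proof.
move=> wL phi.
have near_phi : \forall psi \near phi, `|psi| <= `|phi| + 1.
  near=> psi; rewrite -[psi](subrK phi) addrC (le_trans (ler_normD _ _))//.
  rewrite lerD2l distrC; near: psi.
  by apply: cvgr_dist_le.
exact: wcbs_filter wL near_phi (@dual_norm_weak_cvg phi).
Unshelve. all: by end_near. Qed.

Lemma wcbs_ball_compact L : wcbs L ->
  compact (L @` [set psi : dual E | `|psi| <= 1]).
Proof.
move=> wL; rewrite compact_ultra => G GU GB.
set B := [set psi : dual E | `|psi| <= 1] in GB *.
(* [F0] pulls [G] back to the ball; it is proper because every member of [G] meets the image of the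
   ball. *)
pose F0 := filter_from G (fun U => B `&` L @^-1` U).
have F0F : ProperFilter F0.
  apply: filter_from_proper; last first.
    move=> U GU'; have [a [Ua [psi Bpsi psia]]] := filter_ex (filterI GU' GB).
    by exists psi; split => //=; rewrite psia.
  apply: filter_from_filter => [|U V GU' GV]; first by exists setT; exact: filterT.
  by exists (U `&` V); [exact: filterI|move=> psi [Bpsi [Upsi Vpsi]]].
have [F [FU sF0F]] := ultraFilterLemma F0F.
have FB : F B.
  by apply: sF0F; exists setT; [exact: filterT|move=> psi []].
have [phi phi1 Fphi] := dual_ball_ultra_cvg FU FB.
have LFphi := wcbs_filter _ wL FB Fphi.
(* [L @ F] is a proper filter containing the ultrafilter [G]; maximality makes them equal, so [G]
   converges to [L phi]. *)
have GF : L @ F = G.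
  apply: max_filter => U GU'; apply: sF0F.
  by exists U => // psi [].
exists (L phi); split; first by exists phi.
by rewrite -GF; exact: LFphi.
Qed.

(** Norm continuity makes [L] a bounded operator. The compact image of the ball is closed, [A] being
    Hausdorff, so it is its own closure. *)
Lemma wcbs_compact_op L : wcbs_ops E A L ->
  exists T : compact_op (dual E) A, (T : dual E -> A) = L.
Proof.
move=> [linL wL].
have LP : L \in bounded_op_pred (dual E) A.
  by rewrite inE; split => //; exact: wcbs_continuous.
have TP : BoundedOp LP \in @compact_op_pred R (dual E) A.
  rewrite inE /is_compact_op precompact_closed; first exact: wcbs_ball_compact.
  by apply: compact_closed; [exact: norm_hausdorff|exact: wcbs_ball_compact].
by exists (CompactOp TP).
Qed.

Lemma wcbsZD (a : R[i]) L L' : wcbs L -> wcbs L' -> wcbs (a *: L + L').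
Proof.
move=> wL wL' I le dir psi phi psiM psi_phi.
have FF := net_filter_proper dir.
apply: cvgD; last exact: wL'.
by apply: cvgZr; exact: wL.
Qed.

Lemma wcbs_closed : closed [set T : compact_op (dual E) A | wcbs T].
Proof.
move=> T clT I le dir psi phi [M psiM] psi_phi.
have FF := net_filter_proper dir.
have M0 : 0 <= M by have [[i0] _ _ _] := dir; exact: le_trans (psiM i0).
apply/cvgrPdist_le => e e0.
(* With [T] and [S] at distance below [e / 2 / K], the errors at [phi] and at [psi i] together stay
   below [e / 2]; the summand 1 keeps [K] positive. *)
pose K := M + `|phi| + 1.
have K0 : 0 < K by rewrite ltr_wpDl// addr_ge0.
have dK : 0 < e / 2 / K by rewrite !divr_gt0.
have [S [wS]] := clT _ (nbhsx_ballx T _ dK).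
rewrite -ball_normE/= => TS.
have TSM (xi : dual E) : `|T xi - S xi| <= e / 2 / K * `|xi|.
  apply: (le_trans (opnormP (T - S : compact_op _ _) xi)).
  by rewrite ler_wpM2r// ltW.
have := wS I le dir psi phi (ex_intro _ M psiM) psi_phi.
move=> /cvgrPdist_le/(_ _ (divr_gt0 e0 (ltr0n _ 2))) Se.
near=> i.
(* The outer differences are bounded by [TSM], the middle one by the convergence of [S (psi i)]. *)
have -> : T phi - T (psi i) =
    (T phi - S phi) + (S phi - S (psi i)) - (T (psi i) - S (psi i)).
  by rewrite opprB !addrA !subrK.
rewrite (le_trans (ler_normB _ _))//.
rewrite (le_trans (lerD (ler_normD _ _) (TSM _)))//.
rewrite (@le_trans _ _ (e / 2 / K * `|phi| + e / 2 + e / 2 / K * M))//.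
  rewrite !lerD//; last by rewrite ler_wpM2l// ltW.
  by near: i.
rewrite addrAC -mulrDr [leRHS](splitr e) lerD2r.
rewrite -[leRHS](divfK (lt0r_neq0 K0)).
by rewrite ler_wpM2l ?(ltW dK)// (addrC _ M) lerDl.
Unshelve. all: by end_near. Qed.

End Wcbs.

(** [compact_op] is a type of its own, not a set of maps: the first conjunct ensures that [W]
    captures every wcbs linear operator, and [closed] refers to the operator norm on
    [compact_op]. *)
Theorem theorem2p5 (R : realType) (E A : completeNormedModType R[i]) :
  let W := [set T : compact_op (dual E) A | wcbs_ops E A T] in
  [/\ wcbs_ops E A `<=`
        [set (T : dual E -> A) | T in [set: compact_op (dual E) A]],
      submod_closed [in W] & closed W].
Proof.
move=> W.
(* Linearity comes for free from the type [compact_op]. *)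
have WE : W = [set T : compact_op (dual E) A | wcbs T].
  apply/seteqP; split=> T; first by case.
  by split => //; exact: bounded_op_linear.
split.
- by move=> L /wcbs_compact_op[T <-]; exists T.
- rewrite WE; split=> [|a S T]; rewrite !inE/=.
    move=> I le dir psi phi _ _; have FF := net_filter_proper dir.
    exact: cvg_cst.
  exact: wcbsZD.
- by rewrite WE; exact: wcbs_closed.
Qed.
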